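(* If $f\in L_1$, then $\mathcal{F}_o f\in C_0$ and $f\mathcal{F}_o\in C_0$.
   Context: $\mathcal{G}_{2n}$ is the real Clifford algebra generated by an orthonormal basis $e_1,\dots,e_n,e'_1,\dots,e'_n$ of $\mathbb{R}^{2n}$, with $v^2=v\cdot v$ for all vectors $v$ (so basis vectors square to $1$ and distinct basis vectors anticommute). The norm is $|A|^2=\sum_I\alpha_I^2$ for $A=\sum_I\alpha_I e_I$ in the standard basis of ordered products of basis vectors. Put $B_i=e_ie'_i$; then $B_i^2=-1$ and $B_iB_j=B_jB_i$. The measure is $dm(x)=(2\pi)^{-n/2}dx$ on $\mathbb{R}^n$, with $dx$ Lebesgue measure; $L_1$ is the space of functions $f\colon\mathbb{R}^n\to\mathcal{G}_{2n}$ integrable with respect to $m$. With $I(x,y)=\sum_{i=1}^nB_ix_iy_i$ for $x,y\in\mathbb{R}^n$, the left and right Clifford-Fourier transforms are $$(\mathcal{F}_o f)(y)=\int_{\mathbb{R}^n}e^{-I(x,y)}f(x)\,dm(x),\qquad (f\mathcal{F}_o)(y)=\int_{\mathbb{R}^n}f(x)e^{-I(x,y)}\,dm(x).$$ $C_0$ denotes the space of continuous functions $\mathbb{R}^n\to\mathcal{G}_{2n}$ that vanish at infinity. *)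

(* Defs.v *)
From HB Require Import structures.
From mathcomp Require Import all_boot all_order all_algebra.
From mathcomp Require Import all_classical all_reals all_analysis.

Set Implicit Arguments.
Unset Strict Implicit.
Unset Printing Implicit Defensive.

Import Order.TTheory GRing.Theory Num.Theory.
Import numFieldNormedType.Exports.

Local Open Scope classical_set_scope.
Local Open Scope ring_scope.

Section SymmetricDifference.
Variable N : nat.
Implicit Types A B C : {set 'I_N}.

Definition symdiff A B : {set 'I_N} := [set i | (i \in A) (+) (i \in B)]%SET.

Lemma symdiffC A B : symdiff A B = symdiff B A.
Proof. by apply/setP => i; rewrite !inE addbC. Qed.

Lemma symdiffA A B C : symdiff A (symdiff B C) = symdiff (symdiff A B) C.
Proof. by apply/setP => i; rewrite !inE addbA. Qed.

Lemma symdiff0s A : symdiff finset.set0 A = A.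
Proof. by apply/setP => i; rewrite !inE. Qed.

Lemma symdiffs0 A : symdiff A finset.set0 = A.
Proof. by rewrite symdiffC symdiff0s. Qed.

Lemma symdiffv A : symdiff A A = finset.set0.
Proof. by apply/setP => i; rewrite !inE addbb. Qed.

Lemma symdiffK A : involutive (symdiff A).
Proof. by move=> B; rewrite symdiffA symdiffv symdiff0s. Qed.

Lemma symdiffKr A : involutive (symdiff^~ A).
Proof. by move=> B; rewrite -symdiffA symdiffv symdiffs0. Qed.

Lemma symdiff_eq A B C : (symdiff A B == C) = (B == symdiff A C).
Proof. by apply/eqP/eqP => [<-|->]; rewrite symdiffK. Qed.

End SymmetricDifference.

(* The Clifford algebra of the Euclidean space R^N: an element is the family
   of its coefficients over the ordered products e_A of basis vectors, where
   A ranges over the subsets of the set of indices. *)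
Definition clifford (R : realType) (N : nat) := {ffun {set 'I_N} -> R^o}.

HB.instance Definition _ (R : realType) (N : nat) :=
  GRing.Lmodule.copy (clifford R N) {ffun {set 'I_N} -> R^o}.

Section CliffordRing.
Variables (R : realType) (N : nat).
Implicit Types (A B C : {set 'I_N}) (x y z : clifford R N).

(* Sorting the concatenation of the ordered products e_A and e_B takes one
   transposition of distinct basis vectors for each pair (i, j) in A x B with
   j < i; the squares e_i ^ 2 = 1 then disappear, so that
   e_A e_B = reorder_sign A B *: e_(symdiff A B). *)
Definition reorder_sign A B : R :=
  (-1) ^+ #|[set p : 'I_N * 'I_N |
              [&& p.1 \in A, p.2 \in B & (p.2 < p.1)%N]]%SET|.

Definition cl_basis A : clifford R N := [ffun B => (A == B)%:R].

(* The pairs (A, B) with symdiff A B = C are the (A, symdiff A C). *)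
Definition cl_mul x y : clifford R N :=
  [ffun C => \sum_(A : {set 'I_N})
               reorder_sign A (symdiff A C) * x A * y (symdiff A C)].

Lemma reorder_signE A B : reorder_sign A B =
  \prod_(p : 'I_N * 'I_N | (p.2 < p.1)%N)
    (-1) ^+ ((p.1 \in A) && (p.2 \in B)).
Proof.
rewrite /reorder_sign -sum1dep_card.
rewrite (big_morph (fun k => (-1) ^+ k : R) (@exprD R (-1)) (expr0 _)).
rewrite [LHS]big_mkcond [RHS]big_mkcond/=; apply: eq_bigr => p _; rewrite andbA.
by case: (p.2 < p.1)%N; case: (p.1 \in A); case: (p.2 \in B); rewrite /= ?expr0 ?expr1.
Qed.

Lemma reorder_signDl A B C :
  reorder_sign (symdiff A B) C = reorder_sign A C * reorder_sign B C.
Proof.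
rewrite !reorder_signE -big_split/=; apply: eq_bigr => p _.
by rewrite -signr_addb inE; do 3 case: (_ \in _).
Qed.

Lemma reorder_signDr A B C :
  reorder_sign A (symdiff B C) = reorder_sign A B * reorder_sign A C.
Proof.
rewrite !reorder_signE -big_split/=; apply: eq_bigr => p _.
by rewrite -signr_addb inE; do 3 case: (_ \in _).
Qed.

Lemma reorder_sign0l A : reorder_sign finset.set0 A = 1.
Proof. by rewrite reorder_signE big1// => p _; rewrite inE. Qed.

Lemma reorder_sign0r A : reorder_sign A finset.set0 = 1.
Proof. by rewrite reorder_signE big1// => p _; rewrite inE andbF. Qed.

Lemma cl_mulA : associative cl_mul.
Proof.
move=> x y z; apply/ffunP => D; rewrite !ffunE.
transitivity (\sum_A \sum_B reorder_sign A (symdiff A B) * reorder_sign B (symdiff B D)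
   * x A * y (symdiff A B) * z (symdiff B D)).
  apply: eq_bigr => A _; rewrite ffunE mulr_sumr.
  rewrite (reindex_inj (inv_inj (symdiffK A)))/=; apply: eq_bigr => B _.
  have -> : symdiff (symdiff A B) (symdiff A D) = symdiff B D.
    by rewrite (symdiffC A B) -symdiffA symdiffK.
  have -> : reorder_sign A (symdiff A D) * x A *
    (reorder_sign (symdiff A B) (symdiff B D) * y (symdiff A B) * z (symdiff B D))
   = reorder_sign A (symdiff A D) * reorder_sign (symdiff A B) (symdiff B D)
     * x A * y (symdiff A B) * z (symdiff B D).
    by rewrite !mulrA; do 2 congr (_ * _); rewrite -!mulrA; congr (_ * _); rewrite mulrC.
  do 3 congr (_ * _); rewrite reorder_signDl mulrA -reorder_signDr.
  congr (reorder_sign _ _ * _).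
  by rewrite (symdiffC B) symdiffA -(symdiffA A) symdiffv symdiffs0.
rewrite exchange_big/=; apply: eq_bigr => B _; rewrite ffunE mulr_sumr mulr_suml.
apply: eq_bigr => A _; rewrite !mulrA.
by do 3 congr (_ * _); rewrite mulrC.
Qed.

Lemma cl_mul1x : left_id (cl_basis finset.set0) cl_mul.
Proof.
move=> x; apply/ffunP => C; rewrite ffunE (bigD1 finset.set0)//= big1 => [|A A0].
  by rewrite symdiff0s reorder_sign0l ffunE eqxx !mul1r addr0.
by rewrite ffunE eq_sym (negPf A0) mulr0 mul0r.
Qed.

Lemma cl_mulx1 : right_id (cl_basis finset.set0) cl_mul.
Proof.
move=> x; apply/ffunP => C; rewrite ffunE (bigD1 C)//= big1 => [|A AC].
  by rewrite symdiffv reorder_sign0r ffunE eqxx mul1r mulr1 addr0.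
rewrite [X in _ * X]ffunE eq_sym symdiff_eq symdiffs0 eq_sym (negPf AC).
by rewrite mulr0.
Qed.

Lemma cl_mulDl : left_distributive cl_mul +%R.
Proof.
move=> x y z; apply/ffunP => C; rewrite !ffunE -big_split/=.
by apply: eq_bigr => A _; rewrite ffunE mulrDr mulrDl.
Qed.

Lemma cl_mulDr : right_distributive cl_mul +%R.
Proof.
move=> x y z; apply/ffunP => C; rewrite !ffunE -big_split/=.
by apply: eq_bigr => A _; rewrite ffunE mulrDr.
Qed.

Lemma cl_basis0_neq0 : cl_basis finset.set0 != 0.
Proof.
by apply/eqP => /ffunP/(_ finset.set0)/eqP; rewrite !ffunE eqxx oner_eq0.
Qed.

HB.instance Definition _ := GRing.Zmodule_isNzRing.Build (clifford R N)
  cl_mulA cl_mul1x cl_mulx1 cl_mulDl cl_mulDr cl_basis0_neq0.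

Lemma cl_scaleAl (a : R) x y : a *: (x * y) = (a *: x) * y.
Proof.
apply/ffunP => C; rewrite !ffunE/= /GRing.scale/= mulr_sumr.
by apply: eq_bigr => A _; rewrite !ffunE/= !mulrA (mulrC a).
Qed.

HB.instance Definition _ :=
  GRing.Lmodule_isLalgebra.Build R (clifford R N) cl_scaleAl.

Lemma cl_scaleAr (a : R) x y : a *: (x * y) = x * (a *: y).
Proof.
apply/ffunP => C; rewrite !ffunE/= /GRing.scale/= mulr_sumr.
by apply: eq_bigr => A _; rewrite !ffunE/= mulrCA.
Qed.

HB.instance Definition _ :=
  GRing.Lalgebra_isAlgebra.Build R (clifford R N) cl_scaleAr.

Definition cl_gen (i : 'I_N) : clifford R N := cl_basis [set i]%SET.

Definition cl_norm x : R := Num.sqrt (\sum_A x A ^+ 2).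

Lemma cl_norm_triangle x y : cl_norm (x + y) <= cl_norm x + cl_norm y.
Proof.
have sq_ge0 z : 0 <= \sum_A z A ^+ 2 by apply: sumr_ge0 => A _; exact: sqr_ge0.
have cs : (\sum_A x A * y A) ^+ 2 <= (\sum_A x A ^+ 2) * (\sum_A y A ^+ 2).
  have : 0 <= \sum_A \sum_B (x A * y B - x B * y A) ^+ 2.
    by do 2 apply: sumr_ge0 => ? _; exact: sqr_ge0.
  suff -> : \sum_A \sum_B (x A * y B - x B * y A) ^+ 2 =
      ((\sum_A x A ^+ 2) * (\sum_A y A ^+ 2) - (\sum_A x A * y A) ^+ 2) *+ 2.
    by rewrite pmulrn_lge0// subr_ge0.
  have -> : \sum_A \sum_B (x A * y B - x B * y A) ^+ 2 =
     \sum_A \sum_B (x A ^+ 2 * y B ^+ 2) + \sum_A \sum_B (x B ^+ 2 * y A ^+ 2)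
     - (\sum_A \sum_B (x A * y A) * (x B * y B)) *+ 2.
    rewrite -big_split/= -sumrMnl -sumrB; apply: eq_bigr => A _.
    rewrite -big_split/= -sumrMnl -sumrB; apply: eq_bigr => B _.
    rewrite sqrrB !exprMn addrAC; congr (_ + _ - _ *+ 2).
    by rewrite mulrACA [y B * y A]mulrC mulrACA.
  rewrite [X in _ + X - _]exchange_big/= !mulrnBl; congr (_ - _ *+ 2).
    rewrite -mulr2n mulr_suml; congr (_ *+ 2).
    by apply: eq_bigr => A _; rewrite mulr_sumr.
  by rewrite expr2 mulr_suml; apply: eq_bigr => A _; rewrite mulr_sumr.
rewrite -ler_sqr ?nnegrE ?sqrtr_ge0 ?addr_ge0 ?sqrtr_ge0//.
rewrite sqrrD !sqr_sqrtr//.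
have -> : \sum_A (x + y) A ^+ 2 =
    \sum_A x A ^+ 2 + (\sum_A x A * y A) *+ 2 + \sum_A y A ^+ 2.
  by rewrite -sumrMnl -!big_split/=; apply: eq_bigr => A _; rewrite ffunE sqrrD.
rewrite lerD2r lerD2l ler_pMn2r//.
by rewrite (le_trans (ler_norm _))// -sqrtr_sqr -sqrtrM// ler_wsqrtr.
Qed.

Lemma cl_normZ (a : R) x : cl_norm (a *: x) = `|a| * cl_norm x.
Proof.
rewrite /cl_norm -sqrtr_sqr -sqrtrM ?sqr_ge0// mulr_sumr.
by congr Num.sqrt; apply: eq_bigr => A _; rewrite ffunE exprMn.
Qed.

Lemma cl_norm_eq0 x : cl_norm x = 0 -> x = 0.
Proof.
move/eqP; rewrite sqrtr_eq0 => x0; apply/ffunP => A; rewrite ffunE.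
have : \sum_B x B ^+ 2 == 0.
  by rewrite eq_le x0 sumr_ge0// => B _; exact: sqr_ge0.
rewrite psumr_eq0 => [/allP/(_ A)|B _]; last exact: sqr_ge0.
by rewrite mem_index_enum sqrf_eq0 => /(_ isT)/eqP.
Qed.

HB.instance Definition _ := Lmodule_isNormed.Build R (clifford R N)
  cl_norm_triangle cl_normZ cl_norm_eq0.

Lemma clifford_normE x : `|x| = Num.sqrt (\sum_A x A ^+ 2).
Proof. by []. Qed.

End CliffordRing.

Arguments cl_gen {R N} i.

Section CliffordRelations.
Variables (R : realType) (N : nat).
Implicit Types (A B : {set 'I_N}) (x : clifford R N) (i j : 'I_N).

Lemma clifford_sum_basis x : x = \sum_A x A *: cl_basis R A.
Proof.
apply/ffunP => B; rewrite sum_ffunE (bigD1 B)//= big1 => [|A AB].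
  by rewrite !ffunE eqxx addr0 /GRing.scale/= mulr1.
by rewrite !ffunE (negPf AB) scaler0.
Qed.

Lemma cl_basisM A B : cl_basis R A * cl_basis R B =
  reorder_sign R A B *: cl_basis R (symdiff A B).
Proof.
apply/ffunP => C; rewrite !ffunE (bigD1 A)//= big1 => [|D DA].
  rewrite !ffunE eqxx mulr1 addr0 -symdiff_eq; case: eqP => [<-|_].
    by rewrite symdiffK.
  by rewrite mulr0 scaler0.
by rewrite !ffunE eq_sym (negPf DA) mulr0 mul0r.
Qed.

Lemma cl_gen_sqr i : cl_gen i * cl_gen i = 1 :> clifford R N.
Proof.
rewrite cl_basisM symdiffv reorder_signE big1 ?scale1r// => p lt_p.
by rewrite !inE; case: eqP lt_p => //= ->; case: eqP => //= ->; rewrite ltnn.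
Qed.

Lemma cl_gen_anticomm i j : i != j ->
  cl_gen i * cl_gen j = - (cl_gen j * cl_gen i) :> clifford R N.
Proof.
have sgn k l : reorder_sign R [set k]%SET [set l]%SET = (-1) ^+ (l < k)%N.
  rewrite /reorder_sign; congr (_ ^+ _); have [lk|kl] := ltnP l k.
    rewrite -[RHS](cards1 (k, l)); congr #|pred_of_set _|; apply/setP => -[a b].
    rewrite !inE/= xpair_eqE.
    by case: eqP => //= ->; case: eqP => //= ->; rewrite lk.
  apply/eqP; rewrite cards_eq0; apply/eqP/setP => -[a b]; rewrite !inE/=.
  by case: eqP => //= ->; case: eqP => //= ->; rewrite ltnNge kl.
move=> ij; rewrite !cl_basisM !sgn symdiffC -scaleNr.
by case: (ltngtP i j) ij => [||/val_inj->]; rewrite ?expr1 ?expr0 ?opprK ?eqxx.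
Qed.

Lemma cl_vector_sqr (v : 'rV[R]_N) :
  (\sum_i v 0 i *: cl_gen i) ^+ 2 = (\sum_i v 0 i ^+ 2)%:A :> clifford R N.
Proof.
have e2 : (\sum_i v 0 i *: cl_gen i) ^+ 2 = \sum_i \sum_j
    (v 0 i * v 0 j) *: (cl_gen i * cl_gen j) :> clifford R N.
  rewrite expr2 mulr_suml; apply: eq_bigr => i _; rewrite mulr_sumr.
  by apply: eq_bigr => j _; rewrite -scalerAl -scalerAr scalerA.
apply: (@scalerI _ _ (2 : R)); first by rewrite pnatr_eq0.
rewrite !scaler_nat mulr2n [X in X + _]e2 e2 [X in _ + X]exchange_big/=.
rewrite -big_split/= scaler_suml -sumrMnl; apply: eq_bigr => i _.
rewrite -big_split/= (bigD1 i)//= big1 => [|j ji].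
  by rewrite cl_gen_sqr -expr2 addr0 mulr2n.
by rewrite (mulrC (v 0 j)) (cl_gen_anticomm ji) scalerN subrr.
Qed.

(* The indices in \prod_(i in A) come in increasing order. *)
Lemma cl_basis_prod A : cl_basis R A = \prod_(i in A) cl_gen i.
Proof.
have sprod (s : seq 'I_N) : sorted ltn (map val s) ->
    \prod_(i <- s) cl_gen i = cl_basis R [set i in s]%SET.
  elim: s => [_|i s ih]; first by rewrite big_nil; congr cl_basis; apply/setP.
  rewrite /= big_cons => is_sorted; rewrite ih ?(path_sorted is_sorted)//.
  have lt_is j : j \in s -> (i < j)%N.
    move=> js; have /allP := order_path_min ltn_trans is_sorted.
    by move=> /(_ (val j)); apply; exact: map_f.
  rewrite cl_basisM reorder_signE big1 ?scale1r => [|p lt_p].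
    congr cl_basis; apply/setP => j; rewrite !inE.
    by case: eqVneq => //= ->; apply/negbT/negP => /lt_is; rewrite ltnn.
  rewrite !inE; case: eqP => //= p1; case: (boolP (p.2 \in s)) => //= /lt_is.
  by rewrite -p1 ltnNge ltnW.
rewrite -big_filter sprod; last first.
  apply: (subseq_sorted ltn_trans) (iota_ltn_sorted 0 N).
  rewrite -val_enum_ord; apply: map_subseq.
  by rewrite /index_enum -enumT; exact: filter_subseq.
by congr cl_basis; apply/setP => i; rewrite inE mem_filter mem_index_enum andbT.
Qed.

End CliffordRelations.

Definition cl_exp (R : realType) (N : nat) (x : clifford R N) : clifford R N :=
  limn (series (fun k => k`!%:R^-1 *: x ^+ k)).

Section LebesgueMeasure.
Variables (R : realType) (n : nat).
Implicit Types (a b : 'rV[R]_n) (A : set 'rV[R]_n).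

Definition box a b : set 'rV[R]_n :=
  [set x | forall i, a 0 i <= x 0 i < b 0 i].

Definition box_volume a b : R := \prod_i (b 0 i - a 0 i).

Definition box_cover A (D : set nat) (a b : nat -> 'rV[R]_n) : Prop :=
  (forall k i, a k 0 i <= b k 0 i) /\ A `<=` \bigcup_(k in D) box (a k) (b k).

Definition lebesgue_outer A : \bar R := ereal_inf
  [set s | exists (D : set nat) (a b : nat -> 'rV[R]_n), box_cover A D a b /\
             s = \esum_(k in D) (box_volume (a k) (b k))%:E].

Lemma box_volume_ge0 a b : (forall i, a 0 i <= b 0 i) -> 0 <= box_volume a b.
Proof. by move=> ab; apply: prodr_ge0 => i _; rewrite subr_ge0. Qed.

Lemma box_cover_ge0 A D (a b : nat -> 'rV[R]_n) : box_cover A D a b ->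
  (0 <= \esum_(k in D) (box_volume (a k) (b k))%:E)%E.
Proof.
move=> [ab _]; apply: esum_ge0 => k _.
by rewrite lee_fin; apply: box_volume_ge0.
Qed.

Lemma lebesgue_outer_ge0 A : (0 <= lebesgue_outer A)%E.
Proof.
by apply: le_ereal_inf_tmp => _ [D [a [b [/box_cover_ge0 cov ->]]]].
Qed.

Lemma lebesgue_outer0 : lebesgue_outer set0 = 0%E.
Proof.
apply/eqP; rewrite eq_le lebesgue_outer_ge0 andbT.
apply: ereal_inf_lbound; exists set0, (fun=> 0), (fun=> 0).
by rewrite esum_set0; split => //; split.
Qed.

Lemma le_lebesgue_outer : {homo lebesgue_outer : A B / A `<=` B >-> (A <= B)%E}.
Proof.
move=> A B AB; apply: ereal_inf_le_tmp => _ [D [a [b [[ab BD] ->]]]].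
by exists D, a, b; split => //; split => //; exact: subset_trans BD.
Qed.

Lemma lebesgue_outer_sigma_subadditive : sigma_subadditive lebesgue_outer.
Proof.
move=> A; have [[i ioo]|] := pselect (exists i, lebesgue_outer (A i) = +oo%E).
  rewrite (eseries_pinfty _ _ ioo) ?leey// => k _.
  by rewrite -ltNye (lt_le_trans _ (lebesgue_outer_ge0 _)).
rewrite -forallNE => Aoo; apply/lee_addgt0Pr => _/posnumP[e].
rewrite (le_trans _ (epsilon_trick _ _ _))//; last first.
  by move=> k; exact: lebesgue_outer_ge0.
pose T := (set nat * (nat -> 'rV[R]_n) * (nat -> 'rV[R]_n))%type.
pose vol (t : T) k := (box_volume (t.1.2 k) (t.2 k))%:E.
have [G PG] : {G : nat -> T & forall k,
    box_cover (A k) (G k).1.1 (G k).1.2 (G k).2 /\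
    (\esum_(i in (G k).1.1) vol (G k) i <=
      lebesgue_outer (A k) + (e%:num / (2 ^ k.+1)%:R)%:E)%E}.
  apply: (@choice _ _ (fun k (t : T) => box_cover (A k) t.1.1 t.1.2 t.2 /\
    (\esum_(i in t.1.1) vol t i <=
      lebesgue_outer (A k) + (e%:num / (2 ^ k.+1)%:R)%:E)%E)) => k.
  have fin_Ak : lebesgue_outer (A k) \is a fin_num.
    by rewrite ge0_fin_numE ?lebesgue_outer_ge0// ltey; apply/eqP/Aoo.
  have ek : 0 < e%:num / (2 ^ k.+1)%:R :> R by rewrite divr_gt0// ltr0n expn_gt0.
  have [_ [D [a [b [cov ->]]]] lt_e] := lb_ereal_inf_adherent ek fin_Ak.
  by exists (D, a, b); split => //; exact: ltW.
pose g (p : nat * nat) := vol (G p.1) p.2.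
have g_ge0 p : (0 <= g p)%E by rewrite lee_fin box_volume_ge0//; case: (PG p.1) => -[].
pose E := [set p : nat * nat | (G p.1).1.1 p.2].
apply: (@le_trans _ _ (\esum_(p in E) g p)).
  have /card_esym/ppcard_eqP[f] := card_nat2.
  apply: ereal_inf_lbound.
  exists (f @^-1` E), (fun k => (G (f k).1).1.2 (f k).2), (fun k => (G (f k).1).2 (f k).2).
  split; first split.
  - by move=> k i; case: (PG (f k).1) => -[].
  - move=> x [k _ /((PG k).1.2) [i Di xi]]; exists (f^-1%FUN (k, i)).
      by rewrite /= invK ?inE.
    by rewrite /= invK ?inE.
  - rewrite (reindex_esum (f @^-1` E) E f)//; split.
    + by move=> k.
    + by move=> k l _ _; apply: inj; rewrite inE.
    + move=> p Ep; exists (f^-1%FUN p); last by rewrite invK ?inE.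
      by rewrite /= invK ?inE.
have -> : \esum_(p in E) g p = (\sum_(k <oo) \esum_(i in (G k).1.1) vol (G k) i)%E.
  rewrite nneseries_esumT; last first.
    by move=> k; apply: esum_ge0 => i _; exact: (g_ge0 (k, i)).
  rewrite esum_esum; last by move=> k i _ _; exact: (g_ge0 (k, i)).
  by congr (\esum_(p in _) _); rewrite predeqE => p; split => /= [|[]].
apply: lee_nneseries => [k _ _|k _]; last exact: (PG k).2.
by apply: esum_ge0 => i _; exact: (g_ge0 (k, i)).
Qed.

HB.instance Definition _ := isOuterMeasure.Build R 'rV[R]_n lebesgue_outer
  lebesgue_outer0 lebesgue_outer_ge0 le_lebesgue_outer
  lebesgue_outer_sigma_subadditive.

Definition lebesgue_outer_measure : {outer_measure set 'rV[R]_n -> \bar R} :=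
  lebesgue_outer.

(* R^n with the sigma-algebra of Lebesgue (i.e. Caratheodory) measurable sets. *)
Definition Rn := caratheodory_type lebesgue_outer_measure.

Definition lebesgue_Rn : {measure set Rn -> \bar R} := lebesgue_outer_measure.

(* dm = (2 pi)^(-n/2) dx *)
Definition mRn : {measure set Rn -> \bar R} :=
  mscale (NngNum (powR_ge0 (2 * pi) (- (n%:R / 2)))) lebesgue_Rn.

End LebesgueMeasure.

Section CliffordFourier.
Variables (R : realType) (n : nat).

Definition cl_integral (N : nat) (f : Rn R n -> clifford R N) : clifford R N :=
  [ffun A => \int[mRn R n]_x f x A].

Definition L1 (N : nat) (f : Rn R n -> clifford R N) : Prop :=
  (forall A, measurable_fun [set: Rn R n] (fun x => f x A)) /\
  (\int[mRn R n]_x `|f x|%:E < +oo)%E.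

Definition C0 (N : nat) (g : 'rV[R]_n -> clifford R N) : Prop :=
  continuous g /\
  forall e : R, 0 < e ->
    exists K : set 'rV[R]_n, compact K /\ forall y, ~ K y -> `|g y| < e.

(* The generators of index i < n of clifford R (n + n) are e_1, ..., e_n and
   those of index n + i are e'_1, ..., e'_n. *)
Definition cl_e (i : 'I_n) : clifford R (n + n) := cl_gen (lshift n i).
Definition cl_e' (i : 'I_n) : clifford R (n + n) := cl_gen (rshift n i).
Definition cl_B (i : 'I_n) : clifford R (n + n) := cl_e i * cl_e' i.

Lemma cl_B_sqr i : cl_B i * cl_B i = -1.
Proof.
rewrite /cl_B mulrA -(mulrA (cl_e i)) (@cl_gen_anticomm _ _ (rshift n i)).
  by rewrite mulrN mulNr mulrA cl_gen_sqr mul1r cl_gen_sqr.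
by rewrite eq_rlshift.
Qed.

Lemma cl_B_comm i j : cl_B i * cl_B j = cl_B j * cl_B i.
Proof.
have [->//|ij] := eqVneq i j.
have comm k : k != lshift n i -> k != rshift n i ->
    cl_B i * cl_gen k = cl_gen k * cl_B i.
  move=> kl kr; rewrite /cl_B /cl_e /cl_e' -mulrA.
  rewrite (@cl_gen_anticomm _ _ (rshift n i) k) 1?eq_sym// mulrN [in LHS]mulrA.
  rewrite (@cl_gen_anticomm _ _ (lshift n i) k) 1?eq_sym//.
  by rewrite mulNr opprK -mulrA.
rewrite {2 3}/cl_B mulrA comm ?eq_lshift ?eq_lrshift 1?eq_sym//.
by rewrite -mulrA comm ?eq_rlshift ?eq_rshift 1?eq_sym// mulrA.
Qed.

Definition cl_I (x y : 'rV[R]_n) : clifford R (n + n) :=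
  \sum_i (x 0 i * y 0 i) *: cl_B i.

Definition left_CFT (f : 'rV[R]_n -> clifford R (n + n)) (y : 'rV[R]_n) :=
  cl_integral (fun x => cl_exp (- cl_I x y) * f x).

Definition right_CFT (f : 'rV[R]_n -> clifford R (n + n)) (y : 'rV[R]_n) :=
  cl_integral (fun x => f x * cl_exp (- cl_I x y)).

End CliffordFourier.

(* Main.v *)
Require Import Defs.
From mathcomp Require Import all_boot all_order all_algebra.
From mathcomp Require Import all_classical all_reals all_analysis.
From mathcomp Require Import measurable_realfun lra.

(** The transform is a finite combination of scalar oscillatory integrals, and
    each of them is handled by the Riemann-Lebesgue lemma.

    Reduction to scalars.  The bivectors [B_j] commute and square to -1.  Fix
    one of them, [J].  Then [J B_j] squares to 1, so the elements
    [(1 + J B_j) / 2] and [(1 - J B_j) / 2] are complementary idempotents, and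
    their products [P_s], indexed by families of signs [s], sum to 1
    ([eigenprojection_sum]).  On the range of [P_s] every [B_j] acts as [J] up
    to a sign, so that [- I(x, y) P_s = t_s(x, y) J P_s], where [t_s(x, y)] is
    the signed sum of the products [x_j y_j].  The exponential series therefore
    splits into the series of cosine and sine ([cl_exp_cl_I]):
    [exp (- I(x, y))] is the sum over [s] of
    [cos t_s(x, y) P_s + sin t_s(x, y) J P_s].  The vectors [P_s] and [J P_s] do
    not depend on [x] and [y], hence multiplication by [f x] on either side only
    produces integrals of [cos t_s] or [sin t_s] against coefficients of [f],
    times constant vectors.

    Riemann-Lebesgue ([riemann_lebesgue]).  Let [psi] be [cos] or [sin] and [g]
    be integrable.  Continuity in [y] is dominated convergence.  For the decay,
    translate [x_i] by [h], where [|h| = pi / |y_i|]: this adds [pi] to the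
    phase, hence changes the sign of [psi].  If [g] is the indicator function of
    [A], invariance of the measure under translations bounds twice the integral
    by the measure of the symmetric difference of [A] and its translate
    ([Rintegral_indic_antiperiodic]).  This measure tends to 0 with [h], because
    a set of finite measure is approximated by finite unions of boxes
    ([box_approximation]), for which the claim is a volume estimate.  Linearity
    and the density of simple functions in L1 extend the decay to all integrable
    [g].

    Since the measure is the Caratheodory restriction of an outer measure
    defined by coverings with boxes, the properties of it that are used
    (measurability of half-spaces, invariance under translations, approximation
    by boxes) are derived from these coverings.  In dimension 0 there is no [J],
    but then the domain is a point and there is nothing to prove. *)

Set Implicit Arguments.
Unset Strict Implicit.
Unset Printing Implicit Defensive.

Import Order.TTheory GRing.Theory Num.Theory.
Import numFieldNormedType.Exports.

Local Open Scope classical_set_scope.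
Local Open Scope ring_scope.

(** * The outer measure generated by boxes *)

Section LebesgueOuter.
Variables (R : realType) (n : nat).
Implicit Types (a b x h : 'rV[R]_n) (A B : set 'rV[R]_n) (i : 'I_n).

Lemma lebesgue_outer_box a b : (forall i, a 0 i <= b 0 i) ->
  (lebesgue_outer (box a b) <= (box_volume a b)%:E)%E.
Proof.
move=> ab; apply: ereal_inf_lbound.
exists [set 0%N], (fun=> a), (fun=> b); split.
  by split => // x xab; exists 0%N.
by rewrite esum_set1// lee_fin box_volume_ge0.
Qed.

Lemma box_volumeD1 i a b : box_volume a b =
  (b 0 i - a 0 i) * \prod_(j | j != i) (b 0 j - a 0 j).
Proof. by rewrite /box_volume (bigD1 i). Qed.

(** Cutting every box of a covering along the hyperplane [x_i = c] gives
    coverings of the two parts, without changing the total volume. *)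
Lemma half_space_caratheodory i (c : R) :
  (@lebesgue_outer_measure R n).-caratheodory [set x | x 0 i < c].
Proof.
apply: le_caratheodory_measurable => X.
apply: le_ereal_inf_tmp => _ [D [a [b [[ab Xab] ->]]]].
(* The cut, moved into [a_i, b_i] when the hyperplane misses the box. *)
pose t k := Num.min (b k 0 i) (Num.max c (a k 0 i)).
pose a' k : 'rV[R]_n := \row_j (if j == i then t k else a k 0 j).
pose b' k : 'rV[R]_n := \row_j (if j == i then t k else b k 0 j).
have tP k : a k 0 i <= t k <= b k 0 i.
  by rewrite ge_min lexx/= le_min ab le_max lexx orbT.
have ab' k j : a k 0 j <= b' k 0 j.
  by rewrite mxE; case: eqP => [->|//]; case/andP: (tP k).
have a'b k j : a' k 0 j <= b k 0 j.
  by rewrite mxE; case: eqP => [->|//]; case/andP: (tP k).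
have vol k : box_volume (a k) (b k) =
    box_volume (a k) (b' k) + box_volume (a' k) (b k).
  rewrite !(box_volumeD1 i) !mxE eqxx.
  rewrite [X in _ = _ * X + _](eq_bigr (fun j => b k 0 j - a k 0 j)); last first.
    by move=> j ji; rewrite mxE (negPf ji).
  rewrite [X in _ = _ + _ * X](eq_bigr (fun j => b k 0 j - a k 0 j)); last first.
    by move=> j ji; rewrite mxE (negPf ji).
  by rewrite -mulrDl; congr (_ * _); lra.
have -> : \esum_(k in D) (box_volume (a k) (b k))%:E =
    (\esum_(k in D) (box_volume (a k) (b' k))%:E +
     \esum_(k in D) (box_volume (a' k) (b k))%:E)%E.
  rewrite -esumD => [|k _|k _]; try by rewrite lee_fin box_volume_ge0.
  by apply: eq_esum => k _; rewrite vol.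
apply: leeD; apply: ereal_inf_lbound.
- exists D, a, b'; split => //; split => // x [Xx xc].
  have [k Dk xk] := Xab _ Xx; exists k => // j; rewrite mxE.
  case: eqP (xk j) => [->|//] /andP[-> xb] /=.
  by rewrite lt_min xb lt_max xc.
- exists D, a', b; split => //; split => // x [Xx xc].
  have [k Dk xk] := Xab _ Xx; exists k => // j; rewrite mxE.
  case: eqP (xk j) => [->|//] /andP[ax ->]; rewrite andbT.
  by rewrite ge_min ge_max ax andbT [c <= _]leNgt; move/negP: xc => ->; rewrite orbT.
Qed.

(** Translating a covering preserves volumes, which gives one inequality for
    every [h]; the other one is the same inequality for [- h]. *)
Lemma lebesgue_outer_translate h A :
  lebesgue_outer ((fun x => x + h) @^-1` A) = lebesgue_outer A.
Proof.
have le h' B : (lebesgue_outer ((fun x => x + h')%R @^-1` B) <= lebesgue_outer B)%E.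
  apply: le_ereal_inf_tmp => _ [D [a [b [[ab Bab] ->]]]].
  apply: ereal_inf_lbound; exists D, (fun k => a k - h'), (fun k => b k - h').
  split; first split.
  - by move=> k i; rewrite !mxE lerD2r.
  - move=> x /= /Bab[k Dk xk]; exists k => // i; move: (xk i).
    by rewrite !mxE lerBlDr ltrBrDr.
  - apply: eq_esum => k _; congr EFin; apply: eq_bigr => i _.
    by rewrite !mxE; lra.
have back : (fun x => x - h) @^-1` ((fun x => x + h) @^-1` A) = A.
  by apply/funext => x; rewrite /preimage/= subrK.
by apply/eqP; rewrite eq_le le -{1}back le.
Qed.

Lemma caratheodory_translate h A :
  (@lebesgue_outer_measure R n).-caratheodory A ->
  (@lebesgue_outer_measure R n).-caratheodory ((fun x => x + h) @^-1` A).
Proof.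
move=> cA X; set Y := (fun x => x - h) @^-1` X.
have -> : X = (fun x => x + h) @^-1` Y.
  by apply/funext => x; rewrite /Y /preimage/= addrK.
rewrite preimage_setC -!preimage_setI /= !(lebesgue_outer_translate h); exact: cA.
Qed.

Definition axis_translate i (t : R) x : 'rV[R]_n := x + t *: delta_mx 0 i.

Lemma axis_translateE i t x j :
  axis_translate i t x 0 j = x 0 j + t * (j == i)%:R.
Proof. by rewrite !mxE/=. Qed.

(** The part of [A] that a short translation along the [i]-th axis moves out of
    [A] has small measure.  One side of the symmetric difference suffices: the
    other side is a translate of it, for the opposite translation. *)
Definition small_shift i A := forall e : R, 0 < e -> exists2 d : R, 0 < d &
  forall t, `|t| < d -> (lebesgue_outer (A `\` axis_translate i t @^-1` A) <= e%:E)%E.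

Lemma small_shift0 i : small_shift i set0.
Proof.
by move=> e e0; exists 1 => // t _; rewrite set0D lebesgue_outer0 lee_fin ltW.
Qed.

Lemma lebesgue_outerU A B :
  (lebesgue_outer (A `|` B) <= lebesgue_outer A + lebesgue_outer B)%E.
Proof. exact: (outer_measureU2 (@lebesgue_outer_measure R n)). Qed.

Lemma small_shiftU i A B :
  small_shift i A -> small_shift i B -> small_shift i (A `|` B).
Proof.
move=> sA sB e e0; have e2 : 0 < e / 2 by rewrite divr_gt0.
have [d d0 dA] := sA _ e2; have [d' d'0 dB] := sB _ e2.
exists (Num.min d d'); first by rewrite lt_min d0.
move=> t; rewrite lt_min => /andP[td td'].
have sub : (A `|` B) `\` axis_translate i t @^-1` (A `|` B) `<=`
    (A `\` axis_translate i t @^-1` A) `|` (B `\` axis_translate i t @^-1` B).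
  by move=> x [[Ax|Bx] nAB]; [left|right]; split=> // ?; apply: nAB; [left|right].
rewrite (le_trans (le_lebesgue_outer sub))//.
rewrite (le_trans (lebesgue_outerU _ _))// [e]splitr EFinD.
by apply: leeD; [exact: dA|exact: dB].
Qed.

(** The points of a box that leave it lie in two slabs of thickness [|t|] along
    the faces orthogonal to the [i]-th axis; [V] is the area of these faces. *)
Lemma small_shift_box i a b : (forall j, a 0 j <= b 0 j) ->
  small_shift i (box a b).
Proof.
move=> ab e e0.
pose V := \prod_(j | j != i) (b 0 j - a 0 j).
have V0 : 0 <= V by apply: prodr_ge0 => j _; rewrite subr_ge0.
(* The summand 1 keeps the denominator positive when [V = 0]. *)
exists (e / (2 * (V + 1))); first by rewrite divr_gt0// mulr_gt0// ltr_wpDl.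
move=> t te.
have tV : `|t| * V <= e / 2.
  have : `|t| * (2 * (V + 1)) <= e.
    by rewrite -ler_pdivlMr ?ltW// mulr_gt0// ltr_wpDl.
  by have := normr_ge0 t; lra.
pose lo : 'rV[R]_n := \row_j (if j == i then a 0 i + `|t| else b 0 j).
pose hi : 'rV[R]_n := \row_j (if j == i then b 0 i - `|t| else a 0 j).
have alo j : a 0 j <= lo 0 j by rewrite mxE; case: eqP => [->|//]; rewrite lerDl.
have hib j : hi 0 j <= b 0 j by rewrite mxE; case: eqP => [->|//]; rewrite gerBl.
have sub : box a b `\` axis_translate i t @^-1` box a b `<=` box a lo `|` box hi b.
  move=> x [xab nx].
  have [xlo|loxx] := ltP (x 0 i) (a 0 i + `|t|).
    left => j; rewrite mxE; case: eqP (xab j) => [->|//] /andP[-> _].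
    by rewrite xlo.
  right => j; rewrite mxE; case: eqP (xab j) => [->|//] /andP[_ ->].
  rewrite andbT leNgt; apply/negP => xhi; apply: nx => k.
  rewrite /= axis_translateE; have [->|ki] := eqVneq k i; last first.
    by rewrite mulr0 addr0; exact: xab.
  rewrite mulr1; have := ler_norm t; have := ler_norm (- t); rewrite normrN.
  by move=> ? ?; apply/andP; split; lra.
have volE (u v : 'rV[R]_n) : v 0 i - u 0 i = `|t| ->
    (forall j, j != i -> v 0 j - u 0 j = b 0 j - a 0 j) ->
    box_volume u v = `|t| * V.
  move=> uv uv'; rewrite (box_volumeD1 i) uv; congr (_ * _).
  exact: eq_bigr.
rewrite (le_trans (le_lebesgue_outer sub))// (le_trans (lebesgue_outerU _ _))//.
rewrite [e]splitr EFinD; apply: leeD.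
  rewrite (le_trans (lebesgue_outer_box alo))// lee_fin volE ?mxE ?eqxx//.
    by lra.
  by move=> j ji; rewrite mxE (negPf ji).
rewrite (le_trans (lebesgue_outer_box hib))// lee_fin volE ?mxE ?eqxx//.
  by lra.
by move=> j ji; rewrite mxE (negPf ji).
Qed.

(** Take a countable covering [D] whose total volume exceeds the measure of [A]
    by less than [e], and a finite [F] in [D] that carries the total volume up
    to [e].  What [F] misses is covered by the rest of [D], and what [F] adds is
    contained in the excess of the covering over [A], whose measure is a
    difference because [A] is Caratheodory measurable. *)
Lemma box_approximation A (e : R) : 0 < e ->
  (@lebesgue_outer_measure R n).-caratheodory A -> (lebesgue_outer A < +oo)%E ->
  exists (F : set nat) (a b : nat -> 'rV[R]_n),
    [/\ finite_set F, forall k i, a k 0 i <= b k 0 i,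
     (lebesgue_outer (A `\` \bigcup_(k in F) box (a k) (b k)) <= e%:E)%E &
     (lebesgue_outer (\bigcup_(k in F) box (a k) (b k) `\` A) <= e%:E)%E].
Proof.
move=> e0 cA Aoo.
have Afin : lebesgue_outer A \is a fin_num.
  by rewrite ge0_fin_numE ?lebesgue_outer_ge0.
have [_ [D [a [b [[ab AD] ->]]]] lt_e] := lb_ereal_inf_adherent e0 Afin.
set U := fun F => \bigcup_(k in F) box (a k) (b k).
pose v k := (box_volume (a k) (b k))%:E.
have v0 k : (0 <= v k)%E by rewrite lee_fin box_volume_ge0.
have le_esum G : (lebesgue_outer (U G) <= \esum_(k in G) v k)%E.
  by apply: ereal_inf_lbound; exists G, a, b; split => //; split.
have Dfin : \esum_(k in D) v k \is a fin_num.
  rewrite ge0_fin_numE ?esum_ge0// (lt_trans lt_e)//.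
  by rewrite lte_add_pinfty// ltry.
have [_ [F [finF FD] <-] Flt] := ub_ereal_sup_adherent e0 Dfin.
exists F, a, b; split => //.
- apply: (@le_trans _ _ (\esum_(k in D `&` ~` F) v k)).
    apply: le_trans (le_esum _); apply: le_lebesgue_outer => x [/AD[k Dk xk] nx].
    by exists k => //; split => // Fk; apply: nx; exists k.
  have DE := esumID F D v (fun k _ => v0 k).
  have FE : D `&` F = F by apply/setIidPr.
  rewrite FE (esum_fset finF (fun k _ => v0 k)) in DE.
  have Ffin : (\sum_(k \in F) v k)%R \is a fin_num.
    rewrite ge0_fin_numE ?fsume_ge0//.
    apply: (@le_lt_trans _ _ (\esum_(k in D) v k)); last by rewrite ltey_eq Dfin.
    by apply: esum_ge; exists F.
  have {}Flt : (\esum_(k in D) v k - e%:E < \sum_(k \in F) v k)%E := Flt.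
  by move: Flt; rewrite DE lteBlDr// lteD2lE// => /ltW.
- apply: (@le_trans _ _ (lebesgue_outer (U D `\` A))).
    apply: le_lebesgue_outer => x [[k Fk xk] nA]; split => //; exists k => //.
    exact: FD.
  have := cA (U D); rewrite (_ : U D `&` A = A); last first.
    by rewrite setIC; apply/setIidPl.
  rewrite /= -setDE => UE.
  move: (le_lt_trans (le_esum D) lt_e); rewrite UE lteD2lE//.
  exact: ltW.
Qed.

(** For [U] close to [A], a point of [A] that leaves [A] is outside [U], or
    leaves [U], or moves into the difference of [U] and [A]. *)
Lemma small_shift_caratheodory i A :
  (@lebesgue_outer_measure R n).-caratheodory A -> (lebesgue_outer A < +oo)%E ->
  small_shift i A.
Proof.
move=> cA Aoo e e0; have e3 : 0 < e / 3 by rewrite divr_gt0.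
have [F [a [b [finF ab AU UA]]]] := box_approximation e3 cA Aoo.
set U := (X in lebesgue_outer (_ `\` X)) in AU.
have sU : small_shift i U.
  rewrite /U -bigsetU_fset_set//; apply: big_ind.
  - exact: small_shift0.
  - exact: small_shiftU.
  - by move=> k _; exact: small_shift_box.
have [d d0 dU] := sU _ e3; exists d => // t td.
have sub : A `\` axis_translate i t @^-1` A `<=`
    (A `\` U) `|` ((U `\` axis_translate i t @^-1` U) `|`
                   axis_translate i t @^-1` (U `\` A)).
  move=> x [Ax nAx]; have [Ux|nUx] := pselect (U x); last by left.
  by right; have [Utx|nUtx] := pselect (U (axis_translate i t x)); [right|left].
rewrite (le_trans (le_lebesgue_outer sub))//.
have -> : e = e / 3 + (e / 3 + e / 3) by lra.
rewrite !EFinD (le_trans (lebesgue_outerU _ _))// leeD//.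
rewrite (le_trans (lebesgue_outerU _ _))// leeD// ?dU//.
by rewrite lebesgue_outer_translate.
Qed.

End LebesgueOuter.

(** * Oscillatory integrals over a measure space *)

Section IntegralComplements.
Context d (T : measurableType d) (R : realType) (mu : {measure set T -> \bar R}).
Implicit Types (A : set T) (g phi : T -> R).

Lemma integrable_bounded_mull phi g :
  measurable_fun setT phi -> (forall x, `|phi x| <= 1) ->
  mu.-integrable setT (EFin \o g) ->
  mu.-integrable setT (EFin \o (fun x => phi x * g x)).
Proof.
move=> mphi phi1 ig; apply: (le_integrable _ _ _ ig) => //.
  apply/measurable_EFinP/measurable_funM => //.
  by apply/measurable_EFinP; exact: measurable_int ig.
by move=> x _; rewrite /= lee_fin normrM ler_piMl.
Qed.

Lemma integrable_indic_finite A : measurable A -> (mu A < +oo)%E ->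
  mu.-integrable setT (EFin \o (\1_A : T -> R)).
Proof.
move=> mA Aoo; apply/integrableP; split.
  by apply/measurable_EFinP; exact: measurable_indic.
under eq_integral do rewrite /= ger0_norm//.
by rewrite integral_indic// setIT.
Qed.

Lemma Rintegral_sum (I : finType) (g : I -> T -> R) :
  (forall i, mu.-integrable setT (EFin \o g i)) ->
  \int[mu]_x (\sum_i g i x) = \sum_i \int[mu]_x g i x.
Proof.
move=> ig; rewrite /Rintegral; under eq_integral do rewrite -sumEFin.
rewrite integral_sum// -sum_fine// => i _.
exact: (integrable_fin_num measurableT (ig i)).
Qed.

Lemma le_normr_Rintegral_bounded phi g :
  measurable_fun setT phi -> (forall x, `|phi x| <= 1) ->
  mu.-integrable setT (EFin \o g) ->
  (`|\int[mu]_x (phi x * g x)|%:E <= \int[mu]_x `|(g x)%:E|)%E.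
Proof.
move=> mphi phi1 ig; have ipg := integrable_bounded_mull mphi phi1 ig.
rewrite EFin_normr_Rintegral//.
apply: le_trans (le_abse_integral _ _ _) _ => //; first exact: measurable_int ipg.
apply: ge0_le_integral => //.
- by apply: measurableT_comp => //; exact: measurable_int ipg.
- by apply: measurableT_comp => //; exact: measurable_int ig.
- by move=> x _; rewrite /= lee_fin normrM ler_piMl.
Qed.

Lemma integral_indicB A B : measurable A -> measurable B ->
  (\int[mu]_x `|(\1_A x - \1_B x)%:E| <= mu (A `\` B) + mu (B `\` A))%E.
Proof.
move=> mA mB.
have mAB : measurable (A `\` B) by exact: measurableD.
have mBA : measurable (B `\` A) by exact: measurableD.
have mE C : measurable C -> mu C = (\int[mu]_x (\1_C x)%:E)%E.
  by move=> mC; rewrite integral_indic// setIT.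
rewrite (mE _ mAB) (mE _ mBA) -ge0_integralD//; last 2 first.
  by apply/measurable_EFinP; exact: measurable_indic.
  by apply/measurable_EFinP; exact: measurable_indic.
apply: ge0_le_integral => //.
- apply: measurableT_comp => //.
  by apply/measurable_EFinP/measurable_funB; exact: measurable_indic.
- by apply: emeasurable_funD; apply/measurable_EFinP; exact: measurable_indic.
- move=> x _; rewrite lee_fin !indicE !in_setD; case: (x \in A); case: (x \in B);
  by rewrite /= ?subrr ?subr0 ?sub0r ?normrN ?normr0 ?normr1 ?addr0 ?add0r.
Qed.

(** By Markov's inequality. *)
Lemma integrable_level_set g (c : R) : mu.-integrable setT (EFin \o g) ->
  c != 0 -> measurable (g @^-1` [set c]) -> (mu (g @^-1` [set c]) < +oo)%E.
Proof.
move=> ig c0 mgc; have c0' : 0 < `|c| by rewrite normr_gt0.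
have /integrableP[mg goo] := ig.
have := le_integral_abse mu measurableT mg c0'.
move=> /le_lt_trans/(_ goo) cgoo.
apply: (@le_lt_trans _ _ (mu (setT `&` [set x | (`|c|%:E <= `|(EFin \o g) x|)%E]))).
  apply: le_measure; rewrite ?inE//.
    by apply: emeasurable_fun_c_infty => //; exact: measurableT_comp.
  by move=> x /= gx; split => //=; rewrite gx.
rewrite ltNge leye_eq; apply/negP => /eqP Aoo.
by move: cgoo; rewrite Aoo gt0_muley ?lte_fin.
Qed.

Lemma bounded_Rintegral_cvg (phi_ : nat -> T -> R) phi g :
  (forall k, measurable_fun setT (phi_ k)) -> measurable_fun setT phi ->
  (forall k x, `|phi_ k x| <= 1) -> (forall x, `|phi x| <= 1) ->
  (forall x, phi_ k x @[k --> \oo] --> phi x) ->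
  mu.-integrable setT (EFin \o g) ->
  \int[mu]_x (phi_ k x * g x) @[k --> \oo] --> \int[mu]_x (phi x * g x).
Proof.
move=> mphi_ mphi phi_1 phi1 phi_phi ig; apply: fine_cvg.
have iw := integrable_bounded_mull mphi phi1 ig.
rewrite /Rintegral fineK; last exact: (integrable_fin_num _ iw).
apply: (@dominated_cvg _ _ _ mu setT measurableT
  (fun k x => (phi_ k x * g x)%:E) _ (fun x => `|g x|%:E)) => //.
- move=> k.
  exact: measurable_int (integrable_bounded_mull (mphi_ k) (phi_1 k) ig).
- move=> x _; apply: cvg_EFin; first by near=> k.
  by apply: cvgMr_tmp; exact: phi_phi.
- exact: (integrable_abse ig).
- by move=> k x _; rewrite lee_fin normrM ler_piMl.
Unshelve. all: by end_near. Qed.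

Lemma measurable_signed_sum (n : nat) (c : 'I_n -> T -> R) (a b : 'I_n -> R) :
  (forall j, measurable_fun setT (c j)) ->
  measurable_fun setT (fun x => \sum_j a j * (c j x * b j)).
Proof.
move=> mc; apply: measurable_sum => j; apply: measurable_funM => //.
by apply: measurable_funM => //; exact: mc.
Qed.

End IntegralComplements.

Section MeasurePreserving.
Context d (T : measurableType d) (R : realType) (mu : {measure set T -> \bar R}).
Variable tau : T -> T.
Hypothesis measurable_tau : measurable_fun setT tau.
Hypothesis mu_tau : forall A, mu (tau @^-1` A) = mu A.
Implicit Types (A : set T) (g phi : T -> R).

Lemma integral_pushforward_id (f : T -> \bar R) :
  (\int[pushforward mu tau]_x f x = \int[mu]_x f x)%E.
Proof.
by apply: eq_measure_integral => A mA _; exact: mu_tau.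
Qed.

Lemma integrable_measure_preserving g : mu.-integrable setT (EFin \o g) ->
  mu.-integrable setT (EFin \o (g \o tau)).
Proof.
move=> /integrableP[mg goo].
apply/integrableP; split; first exact: (measurableT_comp mg measurable_tau).
rewrite -integral_pushforward_id in goo.
rewrite ge0_integral_pushforward ?preimage_setT// in goo.
by apply: measurableT_comp.
Qed.

Lemma Rintegral_measure_preserving g : mu.-integrable setT (EFin \o g) ->
  \int[mu]_x g (tau x) = \int[mu]_x g x.
Proof.
move=> ig; rewrite /Rintegral; congr fine.
rewrite -[RHS]integral_pushforward_id (integral_pushforward measurable_tau)//.
- exact: measurable_int ig.
- exact: integrable_measure_preserving.
Qed.

(** Composing with [tau] turns the integral of [phi] over [A] into minus the
    integral of [phi] over the preimage of [A]; adding both forms leaves only the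
    symmetric difference. *)
Lemma Rintegral_indic_antiperiodic phi A :
  measurable_fun setT phi -> (forall x, `|phi x| <= 1) ->
  (forall x, phi (tau x) = - phi x) ->
  measurable A -> (mu A < +oo)%E ->
  (`|(\int[mu]_x (phi x * \1_A x)) *+ 2|%:E <=
   mu (A `\` tau @^-1` A) + mu (tau @^-1` A `\` A))%E.
Proof.
move=> mphi phi1 phitau mA Aoo.
have mtA : measurable (tau @^-1` A).
  by rewrite -[X in measurable X]setTI; exact: measurable_tau.
have tAoo : (mu (tau @^-1` A) < +oo)%E by rewrite mu_tau.
have iA := integrable_indic_finite mA Aoo.
have itA := integrable_indic_finite mtA tAoo.
have ipA := integrable_bounded_mull mphi phi1 iA.
have iptA := integrable_bounded_mull mphi phi1 itA.
have -> : (\int[mu]_x (phi x * \1_A x)) *+ 2 =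
    \int[mu]_x (phi x * (\1_A x - \1_(tau @^-1` A) x)).
  under [RHS]eq_Rintegral do rewrite mulrBr.
  rewrite RintegralB// mulr2n; congr (_ + _).
  rewrite -(Rintegral_measure_preserving ipA) -mulN1r -RintegralZl//.
  by apply: eq_Rintegral => x _; rewrite phitau mulN1r mulNr.
apply: le_trans (integral_indicB mu mA mtA).
by apply: le_normr_Rintegral_bounded => //; exact: (integrableB measurableT iA itA).
Qed.

End MeasurePreserving.

(** * The normalized Lebesgue measure and its translations *)

Section LebesgueMeasure.
Variables (R : realType) (n : nat).
Local Notation Rn := (Rn R n).
Local Notation m := (mRn R n).
Implicit Types (A : set Rn) (i : 'I_n).

Lemma measurable_coord i : measurable_fun [set: Rn] (fun x : Rn => (x : 'rV[R]_n) 0 i).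
Proof.
move=> mT; apply: (measurability _ (RGenInftyO.measurableE R)) => //.
move=> _ [_ [c ->] <-]; rewrite setTI.
rewrite [X in measurable X](_ : _ = [set x : 'rV[R]_n | x 0 i < c]).
  exact: half_space_caratheodory.
by apply/seteqP; split => x; rewrite /= in_itv.
Qed.

Lemma measurable_translate (h : 'rV[R]_n) :
  measurable_fun [set: Rn] ((fun x : 'rV[R]_n => x + h) : Rn -> Rn).
Proof. by move=> _ A mA; rewrite setTI; exact: caratheodory_translate. Qed.

Lemma mRnE (A : set 'rV[R]_n) :
  m A = ((powR (2 * pi) (- (n%:R / 2)))%:E * lebesgue_outer A)%E.
Proof. by []. Qed.

Lemma mRn_translate (h : 'rV[R]_n) (A : set 'rV[R]_n) :
  m ((fun x => x + h) @^-1` A) = m A.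
Proof. by rewrite !mRnE lebesgue_outer_translate. Qed.

Lemma shift_measure_cvg0 i A : measurable A -> (m A < +oo)%E ->
  forall e : R, 0 < e -> exists2 d : R, 0 < d &
  forall t, `|t| < d -> (m (A `\` axis_translate i t @^-1` A) <= e%:E)%E.
Proof.
move=> mA; have c0 : (0 < powR (2 * pi) (- (n%:R / 2)) :> R).
  by rewrite powR_gt0// mulr_gt0// pi_gt0.
rewrite mRnE => Aoo e e0.
have Aoo' : (lebesgue_outer A < +oo)%E.
  rewrite ltNge leye_eq; apply/negP => /eqP Aoo'.
  by move: Aoo; rewrite Aoo' gt0_muley ?lte_fin.
have [|d d0 dA] := small_shift_caratheodory i mA Aoo' (e := e / powR (2 * pi) (- (n%:R / 2))).
  by rewrite divr_gt0.
exists d => // t /dA; rewrite mRnE.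
by rewrite mulrC EFinM lee_pdivlMl.
Qed.

End LebesgueMeasure.

(** * The Riemann-Lebesgue lemma *)

(** [C0] with values in an arbitrary normed space, so that scalar functions and
    functions with values in the Clifford algebra are treated alike. *)
Definition continuous_vanishing (R : realType) (n : nat) (V : normedModType R)
    (g : 'rV[R]_n -> V) : Prop :=
  continuous g /\ forall e : R, 0 < e ->
    exists K : set 'rV[R]_n, compact K /\ forall y, ~ K y -> `|g y| < e.

Lemma cvg_finsum (K : numFieldType) (V : normedModType K) (T : Type)
    (F : set_system T) (I : Type) (r : seq I) (f : I -> T -> V) (l : I -> V) :
  Filter F -> (forall i, f i @ F --> l i) ->
  \sum_(i <- r) f i x @[x --> F] --> \sum_(i <- r) l i.
Proof.
move=> FF fl; elim: r => [|i r ih].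
  by under eq_fun do rewrite big_nil; rewrite big_nil; exact: cvg_cst.
by under eq_fun do rewrite big_cons; rewrite big_cons; exact: cvgD.
Qed.

Section RiemannLebesgue.
Import HBSimple.
Variables (R : realType) (n : nat).
Local Notation Rn := (Rn R n).
Local Notation m := (mRn R n).
Variables (psi : R -> R) (s : {ffun 'I_n -> bool}).
Hypothesis psi_continuous : continuous psi.
Hypothesis psi_bounded : forall t, `|psi t| <= 1.
Hypothesis psi_alternating : alternating psi pi.
Implicit Types (A : set Rn) (g : Rn -> R) (i : 'I_n) (y : 'rV[R]_n).

(** The factor [t] such that [- I(x, y)] acts as [t J] on the joint eigenspace of
    the [B_j] with signs [s]. *)
Definition phase (x y : 'rV[R]_n) : R :=
  \sum_j (-1) ^+ s j * (x 0 j * y 0 j).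

Lemma measurable_wave y :
  measurable_fun [set: Rn] (fun x : Rn => psi (phase x y)).
Proof.
apply: measurableT_comp; first exact: continuous_measurable_fun.
exact: (measurable_signed_sum _ _ (@measurable_coord R n)).
Qed.

Lemma integrable_wave g y : m.-integrable setT (EFin \o g) ->
  m.-integrable setT (EFin \o (fun x => psi (phase x y) * g x)).
Proof. exact: (integrable_bounded_mull (measurable_wave y) (fun=> psi_bounded _)). Qed.

Definition wave_transform g y : R := \int[m]_x (psi (phase x y) * g x).

Lemma wave_transformD g1 g2 y :
  m.-integrable setT (EFin \o g1) -> m.-integrable setT (EFin \o g2) ->
  wave_transform (fun x => g1 x + g2 x) y =
  wave_transform g1 y + wave_transform g2 y.
Proof.
move=> i1 i2; rewrite /wave_transform.
rewrite -RintegralD//; try exact: integrable_wave.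
by apply: eq_Rintegral => x _; rewrite mulrDr.
Qed.

Lemma wave_transformZ c g y : m.-integrable setT (EFin \o g) ->
  wave_transform (fun x => c * g x) y = c * wave_transform g y.
Proof.
move=> ig; rewrite /wave_transform -RintegralZl//; last exact: integrable_wave.
by apply: eq_Rintegral => x _; rewrite mulrCA.
Qed.

(** Decay as a single coordinate of [y] grows.  The bound [M] is uniform in the
    other coordinates, so that decay along all axes is decay at infinity. *)
Definition vanishes_along i g := m.-integrable setT (EFin \o g) /\
  forall e, 0 < e -> exists M : R, forall y, M < `|y 0 i| ->
    `|wave_transform g y| <= e.

(** The translation of length [pi / |y_i|] along the [i]-th axis adds [pi] to the
    phase, and its length tends to 0 as [|y_i|] grows. *)
Lemma vanishes_along_indic i A : measurable A -> (m A < +oo)%E ->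
  vanishes_along i \1_A.
Proof.
move=> mA Aoo; split; first exact: integrable_indic_finite.
move=> e e0; have [d d0 dA] := shift_measure_cvg0 i mA Aoo e0.
exists (pi / d) => y yi.
have y0 : 0 < `|y 0 i| by rewrite (le_lt_trans _ yi)// divr_ge0 ?pi_ge0// ltW.
(* The sign cancels the one in the phase. *)
pose t : R := (-1) ^+ s i * pi / y 0 i.
have td : `|t| < d.
  rewrite /t !normrM normr_sign mul1r normfV ger0_norm ?pi_ge0//.
  by rewrite ltr_pdivrMr// mulrC -ltr_pdivrMr.
have wave_t (x : 'rV[R]_n) : psi (phase (x + t *: delta_mx 0 i) y) = - psi (phase x y).
  rewrite -psi_alternating; congr psi.
  rewrite /phase (bigD1 i)//= [in RHS](bigD1 i)//= [RHS]addrAC; congr (_ + _).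
    rewrite !mxE/= eqxx mulr1 mulrDl mulrDr; congr (_ + _).
    by rewrite /t divfK -?normr_gt0// mulrA -expr2 sqrr_sign mul1r.
  by apply: eq_bigr => j ji; rewrite !mxE (negPf ji) mulr0 addr0.
have := Rintegral_indic_antiperiodic (measurable_translate (t *: delta_mx 0 i))
  (@mRn_translate R n _) (measurable_wave y) (fun=> psi_bounded _) wave_t mA Aoo.
rewrite -/(wave_transform _ y) => wle.
suff : (`|wave_transform \1_A y *+ 2|%:E <= (e *+ 2)%:E)%E.
  by rewrite lee_fin normrMn ler_pMn2r.
apply: le_trans wle _; rewrite mulr2n EFinD leeD//; first exact: dA.
(* The set on the left is the preimage of the one in [dA] for [- t]. *)
apply: le_trans (dA (- t) _); last by rewrite normrN.
rewrite -(mRn_translate (t *: delta_mx 0 i)) le_eqVlt; apply/orP/or_introl/eqP.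
congr (m _); apply/funext => x.
by rewrite /axis_translate /preimage /setD/= scaleNr addrK.
Qed.

Lemma vanishes_along0 i : vanishes_along i (fun=> 0).
Proof.
split; first exact: integrable0.
move=> e e0; exists 0 => y _; rewrite /wave_transform.
under eq_Rintegral do rewrite mulr0.
by rewrite /Rintegral integral0 normr0 ltW.
Qed.

Lemma vanishes_alongD i g1 g2 : vanishes_along i g1 -> vanishes_along i g2 ->
  vanishes_along i (fun x => g1 x + g2 x).
Proof.
move=> [i1 v1] [i2 v2]; split.
  exact: (integrableD measurableT i1 i2).
move=> e e0; have e2 : 0 < e / 2 by rewrite divr_gt0.
have [M1 M1g] := v1 _ e2; have [M2 M2g] := v2 _ e2.
exists (Num.max M1 M2) => y; rewrite gt_max => /andP[yM1 yM2].
rewrite wave_transformD// (le_trans (ler_normD _ _))// [e]splitr.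
by rewrite lerD ?M1g ?M2g.
Qed.

Lemma vanishes_alongZ i c g : vanishes_along i g ->
  vanishes_along i (fun x => c * g x).
Proof.
move=> [ig vg]; split.
  exact: (integrableZl measurableT c ig).
move=> e e0; have e' : 0 < e / (`|c| + 1) by rewrite divr_gt0// ltr_wpDl.
have [M Mg] := vg _ e'; exists M => y yM; rewrite wave_transformZ// normrM.
rewrite (le_trans (ler_wpM2l _ (Mg _ yM)))//.
by rewrite mulrCA ger_pMr// ler_pdivrMr ?mul1r ?lerDl// ltr_wpDl.
Qed.

Lemma vanishes_along_sum i (I : Type) (r : seq I) (g : I -> Rn -> R) :
  (forall k, vanishes_along i (g k)) ->
  vanishes_along i (fun x => \sum_(k <- r) g k x).
Proof.
move=> vg; elim: r => [|k r ih].
  rewrite [X in vanishes_along _ X](_ : _ = (fun=> 0)); first exact: vanishes_along0.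
  by apply/funext => x; rewrite big_nil.
rewrite [X in vanishes_along _ X](_ : _ = (fun x => g k x + \sum_(k <- r) g k x)).
  exact: vanishes_alongD.
by apply/funext => x; rewrite big_cons.
Qed.

Lemma vanishes_along_sfun i (g : {sfun Rn >-> R}) :
  m.-integrable setT (EFin \o g) -> vanishes_along i g.
Proof.
move=> ig; rewrite [X in vanishes_along _ X](funext (fimfunEord g)).
apply: vanishes_along_sum => k; set c := _`_ _.
have [->|c0] := eqVneq c 0.
  rewrite [X in vanishes_along _ X](_ : _ = (fun=> 0)); first exact: vanishes_along0.
  by apply/funext => x; rewrite mul0r.
apply/vanishes_alongZ/vanishes_along_indic => //.
exact: integrable_level_set.
Qed.

(** As [psi] is bounded by 1, the transform is 1-Lipschitz for the L1 norm, so
    decay passes from simple functions to their L1 limits. *)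
Lemma riemann_lebesgue_along i g : m.-integrable setT (EFin \o g) ->
  vanishes_along i g.
Proof.
move=> ig; split=> // e e0; have e2 : 0 < e / 2 by rewrite divr_gt0.
have [g_ [ig_ _ g_g]] := approximation_sfun_integrable measurableT ig.
have [k gk] : exists k, (\int[m]_x `|(g x)%:E - (g_ k x)%:E| <= (e / 2)%:E)%E.
  move/fine_cvgP : g_g => [fing /cvgrPdist_le/(_ _ e2)].
  move=> near_le; near \oo => k; exists k.
  have fin_k : (\int[m]_x `|(g x)%:E - (g_ k x)%:E|)%E \is a fin_num.
    by near: k.
  rewrite -(fineK fin_k) lee_fin.
  apply: le_trans (ler_norm _) _; rewrite -normrN -sub0r.
  by near: k.
have [_ /(_ _ e2)[M Mg]] := vanishes_along_sfun i (ig_ k).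
exists M => y /Mg wgk.
have -> : wave_transform g y = wave_transform (g_ k) y +
    \int[m]_x (psi (phase x y) * (g x - g_ k x)).
  rewrite -[RHS]wave_transformD//.
    by apply: eq_Rintegral => x _; rewrite addrC subrK.
  exact: (integrableB measurableT ig (ig_ k)).
rewrite (le_trans (ler_normD _ _))// [e]splitr lerD//.
have idiff := integrableB measurableT ig (ig_ k).
rewrite -lee_fin; apply: le_trans gk.
exact: (le_normr_Rintegral_bounded (measurable_wave y) (fun=> psi_bounded _) idiff).
Unshelve. all: by end_near. Qed.

(** Dominated convergence ([bounded_Rintegral_cvg]) along a sequence that tends to a
    supposed point of discontinuity while the transform stays away from its value
    there. *)
Lemma wave_transform_continuous g : m.-integrable setT (EFin \o g) ->
  continuous (wave_transform g).
Proof.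
move=> ig y0; apply/(@cvgrPdist_lt _ R^o _ (nbhs y0)) => e e0.
apply: contrapT => far.
have /choice[z zP] : forall k : nat, exists z : 'rV[R]_n,
    ball y0 k.+1%:R^-1 z /\ ~ `|wave_transform g y0 - wave_transform g z| < e.
  move=> k; apply: contrapT => nz; apply: far; apply/nbhs_ballP.
  exists k.+1%:R^-1 => /=; first by rewrite invr_gt0.
  by move=> z yz; apply: contrapT => gz; apply: nz; exists z.
have zy : z @ \oo --> y0.
  apply/cvg_ballP => d d0; near=> k.
  apply: (@le_ball _ _ _ k.+1%:R^-1); last by have [] := zP k.
  by apply: ltW; near: k; exact: near_infty_natSinv_lt (PosNum d0).
have phasez x : phase x (z k) @[k --> \oo] --> phase x y0.
  apply: (@cvg_finsum R R^o) => j; apply: cvgMl_tmp; apply: cvgMl_tmp.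
  exact: (cvg_comp z (fun y : 'rV[R]_n => y 0 j) zy (@coord_continuous R 1 n 0 j y0)).
have wavez x : psi (phase x (z k)) @[k --> \oo] --> psi (phase x y0).
  by apply: (cvg_comp _ psi (phasez x)); exact: psi_continuous.
have wz : wave_transform g (z k) @[k --> \oo] --> wave_transform g y0.
  exact: (bounded_Rintegral_cvg (fun k => measurable_wave (z k))
    (measurable_wave y0) (fun _ _ => psi_bounded _) (fun=> psi_bounded _) wavez ig).
move/(@cvgrPdist_lt R R^o) : wz => /(_ e e0) near_lt; near \oo => k; have [_] := zP k; apply.
by near: k.
Unshelve. all: by end_near. Qed.

(** Outside a product of compact intervals some coordinate is large. *)
Theorem riemann_lebesgue g : m.-integrable setT (EFin \o g) ->
  continuous_vanishing (wave_transform g : 'rV[R]_n -> R^o).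
Proof.
move=> ig; split; first exact: wave_transform_continuous.
move=> e e0; have e2 : 0 < e / 2 by rewrite divr_gt0.
have /choice[M Mg] i := (riemann_lebesgue_along i ig).2 _ e2.
exists [set y : 'rV[R]_n | forall i, `[- M i, M i]%classic (y ord0 i)]; split.
  exact: (rV_compact (fun i => @segment_compact R (- M i) (M i))).
move=> y /existsNP[i yi]; apply: (@le_lt_trans _ _ (e / 2)); last by lra.
apply: (Mg i); rewrite ltNge; apply/negP => yM; apply: yi.
by rewrite /= in_itv/= -ler_norml.
Qed.

End RiemannLebesgue.

(** * The exponential of a combination of commuting bivectors *)

Section ExponentialOfBivectors.
Variables (R : realType) (n : nat) (i0 : 'I_n).
Local Notation cl := (clifford R (n + n)).
Local Notation B := (@cl_B R n).
Local Notation J := (B i0).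
Implicit Types (i j : 'I_n) (b : bool) (s : {ffun 'I_n -> bool}).

(** The idempotent [(1 + (-1)^b J B_j) / 2].  On its range [B_j] coincides with
    [- (-1)^b J]; for [B_j = J] it is 0 or 1. *)
Definition eigenfactor b j : cl := 2^-1 *: (1 + (-1) ^+ b *: (J * B j)).

Definition eigenprojection s : cl := \prod_j eigenfactor (s j) j.

Lemma eigenfactor_sum j : \sum_b eigenfactor b j = 1.
Proof.
rewrite big_bool /= /eigenfactor -scalerDr expr1 expr0 scaleN1r scale1r.
by rewrite addrACA addNr addr0 -[1 + 1](scaler_nat 2 (1 : cl)) scalerA mulVf ?scale1r// pnatr_eq0.
Qed.

(** Expanding the product over [j] of the sums [eigenfactor_sum], all equal to
    1, gives one term for each family of signs. *)
Lemma eigenprojection_sum : \sum_s eigenprojection s = 1.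
Proof.
rewrite -(bigA_distr_bigA (fun j b => eigenfactor b j)).
by rewrite big1// => j _; exact: eigenfactor_sum.
Qed.

Lemma eigenfactor_comm i b j : GRing.comm (B i) (eigenfactor b j).
Proof.
rewrite /GRing.comm /eigenfactor -scalerAl -scalerAr; congr (_ *: _).
rewrite mulrDl mulrDr mulr1 mul1r -scalerAl -scalerAr; congr (_ + _ *: _).
by apply: commrM; exact: cl_B_comm.
Qed.

Lemma eigenfactor_ann b j : (B j + (-1) ^+ b *: J) * eigenfactor b j = 0.
Proof.
rewrite /eigenfactor -scalerAr.
move: (cl_B_sqr R j) (cl_B_sqr R i0) (cl_B_comm R i0 j).
move: (B j) (B i0) => v w vv ww wv.
have -> : (v + (-1) ^+ b *: w) * (1 + (-1) ^+ b *: (w * v)) =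
    v + w * w * v + (-1) ^+ b *: (w + w * (v * v)).
  rewrite mulrDl !mulrDr !mulr1 -!scalerAl -!scalerAr scalerA -expr2 sqrr_sign.
  rewrite scale1r !mulrA -wv scalerDr addrACA [X in _ + X]addrC addrACA.
  by rewrite -!addrA; congr (_ + _); rewrite addrCA.
by rewrite vv ww mulN1r mulrN1 !subrr scaler0 addr0 scaler0.
Qed.

(** The algebra is not commutative: [a] is moved through the product to the
    factor that it annihilates. *)
Lemma comm_prod_eq0 (a : cl) (F : 'I_n -> cl) (r : seq 'I_n) j :
  (forall k, GRing.comm a (F k)) -> a * F j = 0 -> j \in r ->
  a * \prod_(k <- r) F k = 0.
Proof.
move=> aF aFj; elim: r => // k r ih; rewrite inE big_cons => /predU1P[<-|jr].
  by rewrite mulrA aFj mul0r.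
by rewrite mulrA aF -mulrA ih// mulr0.
Qed.

(** [B_j + (-1)^(s j) J] commutes with all the factors of the projection and
    annihilates the [j]-th one. *)
Lemma eigenprojectionP j s :
  B j * eigenprojection s = - ((-1) ^+ s j *: (J * eigenprojection s)).
Proof.
apply/eqP; rewrite -addr_eq0 scalerAl -mulrDl; apply/eqP.
apply: (comm_prod_eq0 (j := j)); last by rewrite mem_index_enum.
  move=> k; apply/commr_sym/commrD; first exact/commr_sym/eigenfactor_comm.
  by rewrite /GRing.comm -(scalerAl _ J) -(scalerAr _ _ J) eigenfactor_comm.
exact: eigenfactor_ann.
Qed.

Lemma cl_I_eigenprojection s x y :
  - cl_I x y * eigenprojection s = phase s x y *: (J * eigenprojection s).
Proof.
rewrite mulNr /cl_I mulr_suml /phase scaler_suml -sumrN; apply: eq_bigr => j _.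
by rewrite -scalerAl (eigenprojectionP j s) scalerN opprK scalerA mulrC.
Qed.

Lemma cl_I_comm i (x y : 'rV[R]_n) : GRing.comm (- cl_I x y) (B i).
Proof.
rewrite /GRing.comm mulNr mulrN /cl_I mulr_suml mulr_sumr; congr (- _).
by apply: eq_bigr => j _; rewrite -scalerAl -scalerAr cl_B_comm.
Qed.

Lemma cl_I_expr_eigenprojection k s (x y : 'rV[R]_n) :
  (- cl_I x y) ^+ k * eigenprojection s =
  phase s x y ^+ k *: (J ^+ k * eigenprojection s).
Proof.
elim: k => [|k ih]; first by rewrite !expr0 scale1r.
rewrite [in LHS]exprS -mulrA ih -scalerAr mulrA (commrX k (@cl_I_comm i0 x y)).
rewrite -mulrA cl_I_eigenprojection -scalerAr scalerA -exprSr.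
by rewrite mulrA -exprSr.
Qed.

(** The powers of [J] run through [1, J, -1, -J], like those of the imaginary
    unit, so the even terms of the exponential series are those of the cosine and
    the odd ones those of the sine, times [J]. *)
Lemma cl_B_expr (t : R) k :
  k`!%:R^-1 *: (t ^+ k *: J ^+ k) =
  cos_coeff t k *: 1 + sin_coeff t k *: J.
Proof.
have sqrX l : J ^+ l.*2 = (-1) ^+ l *: 1.
  by rewrite -mul2n exprM expr2 cl_B_sqr -scaleN1r exprZn expr1n.
have JX : J ^+ k = (-1) ^+ k./2 *: (if odd k then J else 1).
  rewrite -{1}(odd_double_half k) exprD sqrX -scalerAr mulr1.
  by case: (odd k); rewrite ?expr1 ?expr0.
rewrite JX cos_coeffE sin_coeffE !scalerA.
case: (boolP (odd k)) => /= ok.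
  have -> : (k.-1)./2 = k./2.
    by rewrite -[in LHS](odd_double_half k) ok /= half_double.
  rewrite !mul0r scale0r add0r mul1r; congr (_ *: _).
  by rewrite mulrC mulrA.
rewrite !mul0r scale0r addr0 mul1r; congr (_ *: _).
by rewrite mulrC mulrA.
Qed.

Definition wave (b : bool) : R -> R := if b then cos else sin.

(** The constant vector that multiplies the cosine or the sine of the phase with
    signs [p.2] in [exp (- I(x, y))]. *)
Definition wave_vector (p : bool * {ffun 'I_n -> bool}) : cl :=
  if p.1 then eigenprojection p.2 else J * eigenprojection p.2.

(** Multiply the [k]-th term of the exponential series by 1, written as the sum
    of the eigenprojections: on each of them the power of [- I(x, y)] is a
    scalar multiple of a power of [J]. *)
Lemma cl_exp_cl_I (x y : 'rV[R]_n) :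
  cl_exp (- cl_I x y) = \sum_p wave p.1 (phase p.2 x y) *: wave_vector p.
Proof.
apply: cvg_lim => //.
rewrite -(pair_bigA _ (fun b s => wave b (phase s x y) *: wave_vector (b, s)))/=.
rewrite exchange_big/=.
pose u (b : bool) (t : R) := if b then cos_coeff t else sin_coeff t.
have -> : series (fun k => k`!%:R^-1 *: (- cl_I x y) ^+ k) =
  (fun N => \sum_s \sum_b series (u b (phase s x y)) N *: wave_vector (b, s)).
  apply/funext => N; rewrite /series/=.
  transitivity (\sum_(0 <= k < N) \sum_s \sum_b
      u b (phase s x y) k *: wave_vector (b, s)).
    apply: eq_bigr => k _.
    rewrite -[X in _ *: X]mulr1 -eigenprojection_sum mulr_sumr scaler_sumr.
    apply: eq_bigr => s _; rewrite cl_I_expr_eigenprojection scalerAl.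
    by rewrite scalerAl cl_B_expr big_bool /= mulrDl -!scalerAl mul1r.
  rewrite exchange_big/=; apply: eq_bigr => s _.
  rewrite exchange_big/=; apply: eq_bigr => b _.
  by rewrite scaler_suml.
apply: cvg_finsum => s; apply: cvg_finsum => b; apply: cvgZr_tmp.
case: b; rewrite /u /wave.
  by rewrite cos.unlock; exact: is_cvg_series_cos_coeff.
by rewrite sin.unlock; exact: is_cvg_series_sin_coeff.
Qed.

End ExponentialOfBivectors.

(** * Finite combinations of functions that vanish at infinity *)

Section ContinuousVanishing.
Variables (R : realType) (n : nat) (V : normedModType R).
Implicit Types (g : 'rV[R]_n -> V) (h : 'rV[R]_n -> R^o) (v : V).

Lemma continuous_vanishing0 : continuous_vanishing (fun=> 0 : V) (n := n).
Proof.
split; first exact: cst_continuous.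
by move=> e e0; exists set0; split; [exact: compact0|move=> y _; rewrite normr0].
Qed.

Lemma continuous_vanishingD g1 g2 :
  continuous_vanishing g1 -> continuous_vanishing g2 ->
  continuous_vanishing (fun y => g1 y + g2 y).
Proof.
move=> [c1 v1] [c2 v2]; split; first by move=> y; apply: (@cvgD _ _ _ (nbhs y)); [exact: c1|exact: c2].
move=> e e0; have e2 : 0 < e / 2 by rewrite divr_gt0.
have [K1 [cK1 g1K]] := v1 _ e2; have [K2 [cK2 g2K]] := v2 _ e2.
exists (K1 `|` K2); split; first exact: compactU.
move=> y nK; rewrite (le_lt_trans (ler_normD _ _))// [e]splitr ltrD//.
  by apply: g1K => ?; apply: nK; left.
by apply: g2K => ?; apply: nK; right.
Qed.

Lemma continuous_vanishingZ h v : continuous_vanishing h ->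
  continuous_vanishing (fun y => h y *: v).
Proof.
move=> [ch vh]; split; first by move=> y; apply: (@cvgZr_tmp _ _ _ (nbhs y)); exact: ch.
move=> e e0; have v0 : 0 < `|v| + 1 by rewrite ltr_wpDl.
have [K [cK hK]] := vh (e / (`|v| + 1)) (divr_gt0 e0 v0).
exists K; split => // y /hK hy; rewrite normrZ.
rewrite (le_lt_trans (ler_wpM2l _ (_ : _ <= `|v| + 1)))// ?lerDl//.
by rewrite -ltr_pdivlMr.
Qed.

Lemma continuous_vanishing_sum (I : Type) (r : seq I) (h : I -> 'rV[R]_n -> R^o)
    (v : I -> V) : (forall i, continuous_vanishing (h i)) ->
  continuous_vanishing (fun y => \sum_(i <- r) h i y *: v i).
Proof.
move=> hv; elim: r => [|i r ih].
  rewrite [X in continuous_vanishing X](_ : _ = fun=> 0); first exact: continuous_vanishing0.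
  by apply/funext => y; rewrite big_nil.
rewrite [X in continuous_vanishing X](_ : _ =
  (fun y => h i y *: v i + \sum_(i <- r) h i y *: v i)).
  by apply: continuous_vanishingD => //; exact: continuous_vanishingZ.
by apply/funext => y; rewrite big_cons.
Qed.

End ContinuousVanishing.

Lemma continuous_vanishing_rV0 (R : realType) (V : normedModType R)
  (g : 'rV[R]_0 -> V) : continuous_vanishing g.
Proof.
have -> : g = (fun=> g 0) by apply/funext => y; rewrite (thinmx0 y).
split; first exact: cst_continuous.
move=> e e0; exists setT; split; last by move=> y /(_ I).
have -> : [set: 'rV[R]_0] = [set 0] by apply/seteqP; split => // y _; exact: thinmx0.
exact: compact_set1.
Qed.

(** * The Clifford-Fourier transforms *)

Section CliffordFourierC0.
Variables (R : realType) (n : nat).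
Local Notation Rn := (Rn R n).
Local Notation m := (mRn R n).
Local Notation cl := (clifford R (n + n)).

Lemma clifford_coef_le_norm (x : cl) A : `|x A| <= `|x|.
Proof.
rewrite clifford_normE -[leLHS]sqrtr_sqr ler_wsqrtr// (bigD1 A)//= lerDl sumr_ge0// => B _.
exact: sqr_ge0.
Qed.

Lemma integrable_clifford_coef d (T : measurableType d)
    (mu : {measure set T -> \bar R}) (f : T -> cl) A :
  (forall B, measurable_fun setT (fun x => f x B : R)) ->
  (\int[mu]_x `|f x|%:E < +oo)%E ->
  mu.-integrable setT (EFin \o (fun x => f x A : R)).
Proof.
move=> mf foo; apply/integrableP; split.
  by apply/measurable_EFinP; exact: mf.
apply: le_lt_trans foo; apply: ge0_le_integral => //.
- by apply: measurableT_comp => //; apply/measurable_EFinP; exact: mf.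
- apply/measurable_EFinP.
  rewrite [X in measurable_fun _ X](_ : _ = (fun x => Num.sqrt (\sum_B (f x B : R) ^+ 2)))//.
  apply: measurableT_comp.
    by apply: continuous_measurable_fun; exact: sqrt_continuous.
  by apply: measurable_sum => B; apply: measurable_funX; exact: mf.
- by move=> x _; rewrite lee_fin; exact: clifford_coef_le_norm.
Qed.

Lemma L1_integrable_coef (f : Rn -> cl) A : L1 f ->
  m.-integrable setT (EFin \o (fun x => f x A : R)).
Proof. by move=> [mf foo]; exact: (integrable_clifford_coef A mf foo). Qed.

Lemma cl_integral_sum (I : finType) (g : I -> Rn -> R) (v : I -> cl) :
  (forall i, m.-integrable setT (EFin \o g i)) ->
  cl_integral (fun x => \sum_i g i x *: v i) = \sum_i (\int[m]_x g i x) *: v i.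
Proof.
move=> ig; apply/ffunP => A; rewrite ffunE sum_ffunE.
under eq_Rintegral do rewrite sum_ffunE.
transitivity (\int[m]_x (\sum_i (v i A * g i x))).
  by apply: eq_Rintegral => x _; apply: eq_bigr => i _; rewrite ffunE mulrC.
rewrite Rintegral_sum => [|i].
  by apply: eq_bigr => i _; rewrite RintegralZl// ffunE mulrC.
exact: (integrableZl measurableT (v i A) (ig i)).
Qed.

Lemma wave_continuous b : continuous (@wave R b).
Proof. by case: b; [exact: continuous_cos|exact: continuous_sin]. Qed.

Lemma wave_bounded b t : `|@wave R b t| <= 1.
Proof.
case: b; last exact: sin_max.
by rewrite /wave ler_norml cos_geN1 cos_le1.
Qed.

Lemma wave_alternating b : alternating (@wave R b) pi.
Proof. by case: b; [exact: cosDpi|exact: sinDpi]. Qed.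

(** A choice of cosine or sine, of the signs in the phase, and of a coefficient
    of [f]. *)
Local Notation component := ((bool * {ffun 'I_n -> bool}) * {set 'I_(n + n)})%type.

Lemma cl_integral_wave_C0 (f : 'rV[R]_n -> cl) (v : component -> cl) : L1 f ->
  continuous_vanishing (fun y => cl_integral (fun x =>
    \sum_(q : component) (wave q.1.1 (phase q.1.2 x y) * f x q.2) *: v q)).
Proof.
move=> Lf.
have ig (q : component) y := integrable_wave q.1.2 (@wave_continuous q.1.1)
  (@wave_bounded q.1.1) y (L1_integrable_coef q.2 Lf).
rewrite [X in continuous_vanishing X](_ : _ = (fun y => \sum_(q : component)
  wave_transform (@wave R q.1.1) q.1.2 (fun x => f x q.2) y *: v q)).
  apply: continuous_vanishing_sum => q; apply: riemann_lebesgue.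
  - exact: wave_continuous.
  - exact: wave_bounded.
  - exact: wave_alternating.
  - exact: L1_integrable_coef.
by apply/funext => y; rewrite cl_integral_sum.
Qed.

Variable i0 : 'I_n.

Lemma left_kernel_sum (f : 'rV[R]_n -> cl) x y :
  cl_exp (- cl_I x y) * f x = \sum_(q : component)
    (wave q.1.1 (phase q.1.2 x y) * f x q.2) *:
      (wave_vector R i0 q.1 * cl_basis R q.2).
Proof.
rewrite (cl_exp_cl_I i0) {1}(clifford_sum_basis (f x)) mulr_suml.
rewrite -(pair_bigA _ (fun p A => (wave p.1 (phase p.2 x y) * f x A) *:
      (wave_vector R i0 p * cl_basis R A)))/=.
apply: eq_bigr => p _; rewrite mulr_sumr; apply: eq_bigr => A _.
by rewrite -scalerAl -scalerAr scalerA.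
Qed.

Lemma right_kernel_sum (f : 'rV[R]_n -> cl) x y :
  f x * cl_exp (- cl_I x y) = \sum_(q : component)
    (wave q.1.1 (phase q.1.2 x y) * f x q.2) *:
      (cl_basis R q.2 * wave_vector R i0 q.1).
Proof.
rewrite (cl_exp_cl_I i0) {1}(clifford_sum_basis (f x)) mulr_sumr.
rewrite -(pair_bigA _ (fun p A => (wave p.1 (phase p.2 x y) * f x A) *:
      (cl_basis R A * wave_vector R i0 p)))/=.
apply: eq_bigr => p _; rewrite mulr_suml; apply: eq_bigr => A _.
by rewrite -scalerAl -scalerAr scalerA mulrC.
Qed.

End CliffordFourierC0.

(** In positive dimension [B_0] plays the role of [J]. *)
Theorem mainTheorem7 (R : realType) (n : nat)
    (f : 'rV[R]_n -> clifford R (n + n)) :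
  L1 f -> C0 (left_CFT f) /\ C0 (right_CFT f).
Proof.
case: n f => [|n] f Lf; first by split; exact: continuous_vanishing_rV0.
split.
- have -> : left_CFT f = fun y => cl_integral (fun x => \sum_q
      (wave q.1.1 (phase q.1.2 x y) * f x q.2) *:
        (wave_vector R ord0 q.1 * cl_basis R q.2)).
    apply/funext => y; congr cl_integral; apply/funext => x.
    exact: left_kernel_sum.
  exact: cl_integral_wave_C0.
- have -> : right_CFT f = fun y => cl_integral (fun x => \sum_q
      (wave q.1.1 (phase q.1.2 x y) * f x q.2) *:
        (cl_basis R q.2 * wave_vector R ord0 q.1)).
    apply/funext => y; congr cl_integral; apply/funext => x.
    exact: right_kernel_sum.
  exact: cl_integral_wave_C0.
Qed.
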